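(* Let $n\ge3$. For any integer $2\le k\le n$ and any $c<0$, there exist $C_0>0$, $R_0>1$ and a family $\{u_j\}_{j\ge1}\subset C^\infty(\bar B_{R_0}\setminus B_1)$ satisfying $$\left\{\begin{array}{l}\sigma_k(\lambda(A^{u_j}))=1\ \text{ in } B_{R_0}\setminus B_1,\\ u_j>0\ \text{ and }\ \lambda(A^{u_j})\in\Gamma_k\ \text{ in }\bar B_{R_0}\setminus B_1,\\ \frac{\partial u_j}{\partial r}+\frac{n-2}{2}u_j=-\frac{n-2}{2}\,c\,u_j^{\frac{n}{n-2}}\ \text{ on }\partial B_1,\end{array}\right.$$ and $$|u_j|+|u_j^{-1}|+|\nabla u_j|\le C_0\ \text{ in } B_{R_0}\setminus B_1,$$ such that $$\lim_{j\to\infty}\inf_{\partial B_1}|\nabla^2u_j|=\infty.$$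
   Context: $B_R$ is the open ball of radius $R$ centered at the origin in $\mathbb{R}^n$ and $r=|x|$. For a positive $C^2$ function $u$, $$A^u=-\tfrac{2}{n-2}u^{-\frac{n+2}{n-2}}\nabla^2u+\tfrac{2n}{(n-2)^2}u^{-\frac{2n}{n-2}}\nabla u\otimes\nabla u-\tfrac{2}{(n-2)^2}u^{-\frac{2n}{n-2}}|\nabla u|^2I,$$ and $\lambda(M)$ denotes the eigenvalues of a symmetric matrix $M$. $\sigma_k$ is the $k$-th elementary symmetric function and $\Gamma_k=\{\lambda\in\mathbb{R}^n:\sigma_l(\lambda)>0,\ 1\le l\le k\}$. *)

(* Defs.v *)
From HB Require Import structures.
From mathcomp Require Import all_boot all_order all_algebra.
From mathcomp Require Import all_classical all_reals all_analysis.

Set Implicit Arguments.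
Unset Strict Implicit.
Unset Printing Implicit Defensive.

Import Order.TTheory GRing.Theory Num.Theory.
Import numFieldNormedType.Exports.

Local Open Scope classical_set_scope.
Local Open Scope ring_scope.

(* The library norm on ['rV[R]_n] is the sup norm. [norm2] is the Euclidean
   norm on row vectors and the Frobenius norm on matrices. *)
Definition norm2 (R : realType) (m n : nat) (M : 'M[R]_(m, n)) : R :=
  Num.sqrt (\sum_(i < m) \sum_(j < n) M i j ^+ 2).

Definition eball (R : realType) (n : nat) (rho : R) : set 'rV[R]_n :=
  [set x | norm2 x < rho].

Definition ecball (R : realType) (n : nat) (rho : R) : set 'rV[R]_n :=
  [set x | norm2 x <= rho].

Definition esphere (R : realType) (n : nat) (rho : R) : set 'rV[R]_n :=
  [set x | norm2 x = rho].

Arguments eball {R} n rho.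
Arguments ecball {R} n rho.
Arguments esphere {R} n rho.

Definition partial (R : realType) (n : nat) (i : 'I_n) (u : 'rV[R]_n -> R) :
  'rV[R]_n -> R := fun x => 'D_(delta_mx 0 i) u x.

Definition smooth_on (R : realType) (n : nat) (U : set 'rV[R]_n)
    (u : 'rV[R]_n -> R) : Prop :=
  forall (s : seq 'I_n) (x : 'rV[R]_n), U x ->
    {for x, continuous (foldr (@partial R n) u s)} /\
    (forall i : 'I_n, derivable (foldr (@partial R n) u s) x (delta_mx 0 i)).

(* [C^oo(K)] for a closed set [K]: smooth on an open neighbourhood of [K].
   Derivatives at boundary points of [K] are those of the extension; when [K]
   is the closure of its interior they depend only on the values on [K]. *)
Definition smooth_upto (R : realType) (n : nat) (K : set 'rV[R]_n)
    (u : 'rV[R]_n -> R) : Prop :=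
  exists U : set 'rV[R]_n, [/\ open U, K `<=` U & smooth_on U u].

Definition grad (R : realType) (n : nat) (u : 'rV[R]_n -> R) (x : 'rV[R]_n) :
  'rV[R]_n := \row_(i < n) partial i u x.

Definition hess (R : realType) (n : nat) (u : 'rV[R]_n -> R) (x : 'rV[R]_n) :
  'M[R]_n := \matrix_(i < n, j < n) partial i (partial j u) x.

Definition radial_deriv (R : realType) (n : nat) (u : 'rV[R]_n -> R)
    (x : 'rV[R]_n) : R := 'D_((norm2 x)^-1 *: x) u x.

Definition confA (R : realType) (n : nat) (u : 'rV[R]_n -> R) (x : 'rV[R]_n) :
    'M[R]_n :=
  let N : R := n%:R in
  - ((2 / (N - 2) * u x `^ (- ((N + 2) / (N - 2)))) *: hess u x)
  + (2 * N / (N - 2) ^+ 2 * u x `^ (- (2 * N / (N - 2))))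
      *: ((grad u x)^T *m grad u x)
  - (2 / (N - 2) ^+ 2 * u x `^ (- (2 * N / (N - 2))) * norm2 (grad u x) ^+ 2)
      *: 1%:M.

(* The eigenvalues of [M] listed with multiplicity, in an unspecified order;
   they exist for every symmetric [M]. If the characteristic polynomial does
   not split over [R], the value is the zero vector, which lies in no
   [Gamma_cone k] with [1 <= k]. *)
Definition eigvals (R : realType) (n : nat) (M : 'M[R]_n) : 'rV[R]_n :=
  xget 0 [set l : 'rV[R]_n | char_poly M = \prod_(i < n) ('X - (l 0 i)%:P)].

Definition sigma (R : realType) (n : nat) (k : nat) (l : 'rV[R]_n) : R :=
  \sum_(S : {set 'I_n} | #|S| == k) \prod_(i in S) l 0 i.

Definition Gamma_cone (R : realType) (n : nat) (k : nat) : set 'rV[R]_n :=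
  [set l | forall m : nat, (1 <= m <= k)%N -> 0 < sigma m l].

(* Main.v *)
Require Import Defs.
From HB Require Import structures.
From mathcomp Require Import all_boot all_order all_algebra.
From mathcomp Require Import all_classical all_reals all_analysis.
From mathcomp Require Import ring lra.

Set Implicit Arguments.
Unset Strict Implicit.
Unset Printing Implicit Defensive.

Import Order.TTheory GRing.Theory Num.Theory.
Import numFieldNormedType.Exports.

Local Open Scope classical_set_scope.
Local Open Scope ring_scope.

(* The solutions are radial. With t = ln |x|, m = (n - 2) / 2 and
   u = exp (- m (t + xi(t))), the matrix A^u has the eigenvalue e^(2 xi) S of
   multiplicity n - 1 and the simple eigenvalue e^(2 xi) (p' - S), where p = xi'
   and S = (1 - p^2) / 2, so that sigma_k = 1 becomes
     'C(n - 1, k - 1) e^(2 k xi) S^(k - 1) (p' + (n - 2 k) / k S) = 1,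
   while the boundary condition becomes p(0) = c e^(- xi(0)). Prescribing
   S(0) = e, i.e. p(0) = - sqrt (1 - 2 e), fixes xi(0), and the C^1 norm stays
   bounded on a common annulus as e -> 0. But p'(0) is of order e^(1 - k), and
   k >= 2, so the second derivatives on the unit sphere blow up. Below,
   xi = xi0 - y with y(0) = 0. *)

(** * Spectrum of scalar plus rank-one matrices *)

(** The bordered matrix [B] is eliminated in two ways: with its unit block, and with its block
    [p%:M]. The second leaves an extra factor [p], cancelled since [p != 0]. An integral domain
    suffices, so [p] may be the polynomial ['X - a%:P]. *)
Lemma det_scalar_rank1 (K : idomainType) (n : nat) (p : K) (x y : 'rV[K]_n.+1) :
  p != 0 -> \det (p%:M - x^T *m y) = p ^+ n * (p - (y *m x^T) 0 0).
Proof.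
move=> p0.
pose B : 'M[K]_(1 + n.+1) := block_mx (1%:M) y (x^T) (p%:M).
have detB : \det B = \det (p%:M - x^T *m y).
  have -> : B = block_mx (1%:M) 0 (x^T) (1%:M) *m block_mx (1%:M) y 0 (p%:M - x^T *m y).
    by rewrite mulmx_block !mul1mx !mul0mx !mulmx1 !addr0 [_ + (_ - _)]addrC subrK.
  by rewrite det_mulmx det_lblock det_ublock !det1 !mul1r.
have : \det B * p = (p - (y *m x^T) 0 0) * p ^+ n.+1.
  have -> : (\det B) * p = \det (B *m block_mx (p%:M) 0 (- x^T) (1%:M)).
    by rewrite det_mulmx det_lblock det1 mulr1 det_scalar1.
  rewrite mulmx_block !mul1mx !mulmx0 !mulmx1 !add0r mulmxN mul_mx_scalar.
  rewrite mul_scalar_mx scalerN subrr det_ublock det_scalar det_mx11.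
  by rewrite !mxE eqxx mulr1n.
rewrite detB exprS [p * _]mulrC mulrA => /(mulIf p0) ->; by rewrite mulrC.
Qed.

Lemma char_poly_scalar_rank1 (K : idomainType) (n : nat) (a b : K)
    (x : 'rV[K]_n.+1) :
  char_poly (a%:M + b *: (x^T *m x)) =
  ('X - a%:P) ^+ n * ('X - (a + b * (x *m x^T) 0 0)%:P).
Proof.
have -> : char_poly (a%:M + b *: (x^T *m x)) =
    \det (('X - a%:P)%:M - (map_mx polyC x)^T *m map_mx polyC (b *: x)).
  rewrite /char_poly /char_poly_mx map_mxD map_scalar_mx opprD addrA.
  congr (\det (_ - _)); first by rewrite [RHS]raddfB.
  by rewrite map_trmx -map_mxM -scalemxAr.
rewrite det_scalar_rank1 ?polyXsubC_eq0 // map_trmx -map_mxM -scalemxAl !mxE.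
by rewrite polyCD opprD addrA.
Qed.

(** Vieta's formula, by expanding the product over subsets of factors. It reads [sigma] off the
    characteristic polynomial, so the order chosen by [eigvals] is immaterial. *)
Lemma sigma_coef (R : realType) (n k : nat) (l : 'rV[R]_n) : (k <= n)%N ->
  sigma k l = (-1) ^+ k * (\prod_(i < n) ('X - (l 0 i)%:P))`_(n - k).
Proof.
move=> kn.
have -> : \prod_(i < n) ('X - (l 0 i)%:P) =
    \sum_(S : {set 'I_n}) (\prod_(i in S) (- l 0 i)) *: 'X^(n - #|S|).
  under eq_bigr => i _ do rewrite addrC.
  rewrite bigA_distr; apply: eq_bigr => S _.
  rewrite (bigID (mem S)) /= -mul_polyC rmorph_prod; congr (_ * _).
    by apply: eq_bigr => i ->; rewrite rmorphN.
  under eq_bigr => i /negbTE -> do [].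
  rewrite prodr_const; congr (_ ^+ _).
  rewrite -cardsE (_ : finset _ = (~: S)%SET); first by rewrite cardsCs finset.setCK card_ord.
  by apply/setP => i; rewrite !inE.
rewrite coef_sum mulr_sumr (bigID (fun S : {set 'I_n} => #|S| == k)) /=.
rewrite [X in _ + X]big1 ?addr0 => [|S Sk]; last first.
  rewrite coefZ coefXn; case: eqP => [e|]; last by rewrite !mulr0.
  move/eqP: Sk; have := max_card (mem S); rewrite card_ord => Sn.
  by case; rewrite -(subKn Sn) -e subKn.
apply: eq_bigr => S /eqP Sk; rewrite coefZ coefXn Sk eqxx mulr1 prodrN Sk.
by rewrite mulrA -exprD addnn -mul2n exprM sqrrN expr1n expr1n mul1r.
Qed.

Lemma coef_XsubC_exp (K : comNzRingType) (n j : nat) (a : K) : (j <= n)%N ->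
  (('X - a%:P) ^+ n)`_(n - j) = (- a) ^+ j *+ 'C(n, j).
Proof.
move=> jn; rewrite -polyCN addrC exprDn coef_sum.
have jn1 : (j < n.+1)%N by [].
rewrite (bigD1 (rev_ord (Ordinal jn1))) //= subSS.
rewrite coefMn -polyC_exp coefCM coefXn eqxx mulr1 bin_sub // subKn //.
rewrite big1 ?addr0 // => i; rewrite -val_eqE /= subSS => ij.
rewrite coefMn -polyC_exp coefCM coefXn [_ == _]eq_sym.
by rewrite (negbTE ij) mulr0 mul0rn.
Qed.

Lemma eigvals_char_poly (R : realType) (n : nat) (M : 'M[R]_n) (l : 'rV[R]_n) :
  char_poly M = \prod_(i < n) ('X - (l 0 i)%:P) ->
  char_poly M = \prod_(i < n) ('X - (eigvals M 0 i)%:P).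
Proof.
move=> Ml; rewrite /eigvals.
by case: xgetP => [l' _ -> //|/(_ l)]; rewrite /= Ml.
Qed.

(** The eigenvalues are [a], [n.-1] times, and one simple eigenvalue in the direction of [x]. The
    two terms count the [k]-subsets that avoid or contain the simple one. *)
Lemma sigma_eigvals_scalar_rank1 (R : realType) (n k : nat) (a b : R)
    (x : 'rV[R]_n) : (1 <= k <= n)%N ->
  sigma k (eigvals (a%:M + b *: (x^T *m x))) =
  'C(n.-1, k)%:R * a ^+ k +
  'C(n.-1, k.-1)%:R * (a + b * (x *m x^T) 0 0) * a ^+ k.-1.
Proof.
case: n k x => [|n] [|k] // x; rewrite ltnS /= => kn.
set M := _ + _; set c := a + _.
have cM : char_poly M = ('X - a%:P) ^+ n * ('X - c%:P).
  exact: char_poly_scalar_rank1.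
have /eigvals_char_poly eM : char_poly M = \prod_(i < n.+1)
    ('X - ((\row_j (if j == ord_max then c else a)) 0 i)%:P).
  rewrite cM big_ord_recr /= !mxE eqxx; congr (_ * _).
  rewrite -[n in LHS](card_ord n) -prodr_const; apply: eq_bigr => i _.
  by rewrite !mxE -val_eqE /= ltn_eqF.
rewrite sigma_coef // -eM cM mulrBr coefB coefMC coefMX subSS.
(* In the boundary case [k = n] the left side is 0 by convention, and so is the binomial
   coefficient. *)
have -> : (if (n - k == 0)%N then 0 else (('X - a%:P) ^+ n)`_(n - k).-1) =
    (- a) ^+ k.+1 *+ 'C(n, k.+1).
  case: (ltnP k n) => [kn'|nk].
    by rewrite subn_eq0 leqNgt kn' /= -subnS coef_XsubC_exp.
  by rewrite subn_eq0 nk bin_small ?mulr0n.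
rewrite coef_XsubC_exp // -(mulr_natl (_ ^+ k.+1)) -(mulr_natl (_ ^+ k)).
rewrite [(- a) ^+ k.+1]exprNn [(- a) ^+ k]exprNn.
have e : ((-1) ^+ k * (-1) ^+ k = 1 :> R).
  by rewrite -exprD addnn -mul2n exprM sqrrN expr1n expr1n.
rewrite !exprS; move: e; set s := (-1) ^+ k => e.
transitivity ((s * s) * ('C(n, k.+1)%:R * (a * a ^+ k) + 'C(n, k)%:R * c * a ^+ k)).
  by ring.
by rewrite e mul1r.
Qed.

(** * Smoothness from algebras stable under differentiation *)

Inductive gen_alg (R : realType) (T : Type) (G : set (T -> R)) :
    (T -> R) -> Prop :=
  | gen_alg_cst a : gen_alg G (fun=> a)
  | gen_alg_gen g : G g -> gen_alg G g
  | gen_algD f g : gen_alg G f -> gen_alg G g -> gen_alg G (fun x => f x + g x)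
  | gen_algM f g : gen_alg G f -> gen_alg G g -> gen_alg G (fun x => f x * g x).

Lemma gen_algX (R : realType) (T : Type) (G : set (T -> R)) (f : T -> R) (k : nat) :
  gen_alg G f -> gen_alg G (fun x => f x ^+ k).
Proof.
move=> Gf; elim: k => [|k IHk]; first exact: gen_alg_cst.
rewrite (_ : (fun x => _) = (fun x => f x * f x ^+ k)); first exact: gen_algM.
by apply/funext => x; rewrite exprS.
Qed.

(** By the Leibniz rule, once the partial derivatives of the generators lie in the algebra, those of
    every element do. Iterated derivatives then never leave it, and no formula for them is
    needed. *)
Lemma smooth_on_gen_alg (R : realType) (n : nat) (U : set 'rV[R]_n)
    (G : set ('rV[R]_n -> R)) : open U ->
  (forall g x, G g -> U x -> {for x, continuous g}) ->
  (forall g i, G g -> exists2 dg, gen_alg G dg &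
     forall x, U x -> is_derive x (delta_mx 0 i) g (dg x)) ->
  forall f, gen_alg G f -> smooth_on U f.
Proof.
move=> oU cG dG.
have dA f i : gen_alg G f -> exists2 df, gen_alg G df &
    forall x, U x -> is_derive x (delta_mx 0 i) f (df x).
  elim=> [a|g Gg|g h Gg [dg Gdg dgE] Gh [dh Gdh dhE]|
          g h Gg [dg Gdg dgE] Gh [dh Gdh dhE]].
  - by exists (fun=> 0) => [|x _]; [exact: gen_alg_cst|exact: is_derive_cst].
  - exact: dG.
  - exists (fun x => dg x + dh x) => [|x Ux]; first exact: gen_algD.
    by apply: is_deriveD; [exact: dgE|exact: dhE].
  - exists (fun x => g x * dh x + h x * dg x) => [|x Ux].
      by apply: gen_algD; exact: gen_algM.
    by apply: is_deriveM; [exact: dgE|exact: dhE].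
have cA f x : gen_alg G f -> U x -> {for x, continuous f}.
  move=> Gf Ux; elim: Gf => [a|g Gg|g h _ cg _ ch|g h _ cg _ ch].
  - exact: cst_continuous.
  - exact: cG.
  - exact: continuousD.
  - exact: continuousM.
move=> f Gf s x Ux.
(* The agreement holds on [U] only; openness of [U] makes it hold near each point, which is enough
   to differentiate again. *)
have [h Gh fh] : exists2 h, gen_alg G h &
    forall y, U y -> foldr (@partial R n) f s y = h y.
  elim: s => [|i s [h Gh hE]] /=; first by exists f.
  have [dh Gdh dhE] := dA h i Gh; exists dh => // y Uy.
  have nE : \near y, foldr (@partial R n) f s y = h y.
    by near=> z; apply: hE; near: z; exact: open_nbhs_nbhs.
  by rewrite /partial (near_eq_derive _ nE); case: (dhE y Uy).
have nE : {near x, h =1 foldr (@partial R n) f s}.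
  by near=> z; rewrite fh //; near: z; exact: open_nbhs_nbhs.
split=> [|i].
  have := cA h x Gh Ux; rewrite /prop_for /continuous_at  -?fh //.
  move=> c.
  apply: cvg_trans c.
  exact: (@near_eq_cvg _ _ (nbhs x) _ h _ nE).
have [dh Gdh /(_ x Ux)[d _]] := dA h i Gh.
exact: near_eq_derivable nE d.
Unshelve. all: by end_near. Qed.

(** * Calculus of radial functions *)

Lemma is_derive_line (R : realType) (n : nat) (f : 'rV[R]_n -> R)
    (x v : 'rV[R]_n) (d : R) :
  is_derive (0 : R) 1 (fun h : R => f (h *: v + x)) d -> is_derive x v f d.
Proof.
case=> df dE; apply: (@DeriveDef _ _ _ _ _ f); first exact: ((derivable1P _ _ _).2 df).
rewrite -dE /derive; set g1 := fun h => h^-1 *: _; set g2 := fun h => h^-1 *: _.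
suff -> : g1 = g2 by []; apply/funext => h; rewrite /g1 /g2 /=.
by rewrite addr0 scale0r add0r [_%:A]mulr1.
Qed.

(** The radial variable is the squared Euclidean norm: it is polynomial in the coordinates, and its
    matrix form is the one met in the rank-one spectrum. *)
Definition nsq (R : realType) (n : nat) (x : 'rV[R]_n) : R := (x *m x^T) 0 0.

Lemma nsqE (R : realType) (n : nat) (x : 'rV[R]_n) :
  nsq x = \sum_(i < n) x 0 i ^+ 2.
Proof. by rewrite /nsq mxE; apply: eq_bigr => i _; rewrite !mxE expr2. Qed.

Lemma norm2_nsq (R : realType) (n : nat) (x : 'rV[R]_n) :
  norm2 x = Num.sqrt (nsq x).
Proof. by rewrite /norm2 big_ord1 nsqE. Qed.

Lemma nsq_ge0 (R : realType) (n : nat) (x : 'rV[R]_n) : 0 <= nsq x.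
Proof. by rewrite nsqE; apply: sumr_ge0 => i _; exact: sqr_ge0. Qed.

Lemma nsqZ (R : realType) (n : nat) (a : R) (x : 'rV[R]_n) :
  nsq (a *: x) = a ^+ 2 * nsq x.
Proof.
by rewrite !nsqE mulr_sumr; apply: eq_bigr => i _; rewrite !mxE exprMn.
Qed.

Lemma continuous_nsq (R : realType) (n : nat) : continuous (@nsq R n).
Proof.
rewrite (_ : @nsq R n = fun x => \sum_(i < n) x 0 i ^+ 2); last first.
  by apply/funext => x; rewrite nsqE.
apply: continuous_big => [|i _ x]; first exact: add_continuous.
apply: (@continuous_comp _ _ _ (fun x : 'rV[R]_n => x 0 i) (@GRing.exp R ^~ 2)).
  exact: coord_continuous.
exact: exprn_continuous.
Qed.

(** Along a line [nsq] is a quadratic polynomial, so the chain rule in one variable applies. The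
    direction [v] is a basis vector for partial derivatives and [x] itself for the radial
    derivative. *)
Lemma is_derive_radial (R : realType) (n : nat) (F : R -> R) (dF : R)
    (x v : 'rV[R]_n) : is_derive (nsq x) 1 F dF ->
  is_derive x v (F \o @nsq R n) (dF * (2 * (x *m v^T) 0 0)).
Proof.
move=> HF; apply: is_derive_line.
set b := (x *m v^T) 0 0.
have e (h : R) : nsq (h *: v + x) = nsq v * h ^+ 2 + 2 * b * h + nsq x.
  rewrite !nsqE /b mxE !(mulr_sumr, mulr_suml) -!big_split /=.
  by apply: eq_bigr => i _; rewrite !mxE; ring.
rewrite (_ : (fun h => _) =
  F \o (fun h : R => nsq v * h ^+ 2 + 2 * b * h + nsq x)); last first.
  by apply/funext => h; rewrite /= e.
apply: is_derive1_comp.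
  by rewrite expr0n /= !mulr0 !add0r.
apply: is_derive_eq.
by rewrite /GRing.scale /=; ring.
Qed.

(** Coordinates are added to the generators because each partial derivative of [h \o nsq] brings out
    a factor [2 * x 0 i]. Smoothness in several variables thus reduces to closure of [H] under
    one-variable differentiation. *)
Lemma smooth_on_radial (R : realType) (n : nat) (J : set R) (H : set (R -> R)) :
  open J ->
  (forall f, H f -> exists2 df, gen_alg H df &
     forall s, J s -> is_derive s 1 f (df s)) ->
  forall f, H f -> smooth_on (@nsq R n @^-1` J) (f \o @nsq R n).
Proof.
move=> oJ dH f Hf.
pose G := [set g : 'rV[R]_n -> R | (exists i, g = fun x => x 0 i) \/
  (exists2 h, H h & g = h \o @nsq R n)].
apply: (@smooth_on_gen_alg _ _ _ G); last by apply: gen_alg_gen; right; exists f.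
- by apply: open_comp => // x _; exact: continuous_nsq.
- move=> g x [[i ->] _|[h Hh ->] Jx]; first exact: coord_continuous.
  apply: continuous_comp; first exact: continuous_nsq.
  have [dh _ /(_ _ Jx)[dhx _]] := dH h Hh.
  exact/differentiable_continuous/derivable1_diffP.
- move=> g i [[j ->]|[h Hh ->]].
    exists (fun=> (delta_mx 0 i : 'rV[R]_n) 0 j) => [|x _].
      exact: gen_alg_cst.
    apply: is_derive_line.
    rewrite (_ : (fun h => _) =
      fun h : R => (delta_mx 0 i : 'rV[R]_n) 0 j * h + x 0 j); last first.
      by apply/funext => h; rewrite !mxE mulrC.
    by apply: is_derive_eq; rewrite /GRing.scale /=; ring.
  have [dh Gdh dhE] := dH h Hh.
  exists (fun x => dh (nsq x) * (2 * x 0 i)) => [|x Jx]; last first.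
    have := is_derive_radial (delta_mx 0 i) (dhE _ Jx).
    by rewrite trmx_delta -colE mxE.
  apply: gen_algM; last first.
    by apply: gen_algM; [exact: gen_alg_cst|apply: gen_alg_gen; left; exists i].
  elim: Gdh => [a|k Hk|k l _ Gk _ Gl|k l _ Gk _ Gl].
  - exact: gen_alg_cst.
  - by apply: gen_alg_gen; right; exists k.
  - exact: gen_algD.
  - exact: gen_algM.
Qed.

Lemma dot_delta (R : realType) (n : nat) (i : 'I_n) (x : 'rV[R]_n) :
  (x *m (delta_mx 0 i : 'rV[R]_n)^T) 0 0 = x 0 i.
Proof. by rewrite trmx_delta -colE mxE. Qed.

Lemma partial_radial (R : realType) (n : nat) (F : R -> R) (dF : R) (i : 'I_n)
    (x : 'rV[R]_n) : is_derive (nsq x) 1 F dF ->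
  partial i (F \o @nsq R n) x = 2 * dF * x 0 i.
Proof.
move=> HF; have [_] := is_derive_radial (delta_mx 0 i) HF.
by rewrite /partial dot_delta => ->; ring.
Qed.

Lemma grad_radial (R : realType) (n : nat) (F : R -> R) (dF : R)
    (x : 'rV[R]_n) : is_derive (nsq x) 1 F dF ->
  grad (F \o @nsq R n) x = (2 * dF) *: x.
Proof. by move=> HF; apply/rowP => i; rewrite !mxE (partial_radial _ HF). Qed.

Lemma hess_radial (R : realType) (n : nat) (J : set R) (F F1 : R -> R) (F2 : R)
    (x : 'rV[R]_n) : open J -> J (nsq x) ->
  (forall s, J s -> is_derive s 1 F (F1 s)) -> is_derive (nsq x) 1 F1 F2 ->
  hess (F \o @nsq R n) x = (2 * F1 (nsq x))%:M + (4 * F2) *: (x^T *m x).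
Proof.
move=> oJ Jx dF dF1; apply/matrixP => i j; rewrite !mxE big_ord1 !mxE.
have nE : \forall z \near x,
    partial j (F \o @nsq R n) z = (2 * (F1 \o @nsq R n) z) * z 0 j.
  have oU : open (@nsq R n @^-1` J).
    by apply: open_comp => // z _; exact: continuous_nsq.
  near=> z; apply: partial_radial; apply: dF; near: z.
  exact: (open_nbhs_nbhs (conj oU Jx)).
rewrite {1}/partial (near_eq_derive _ nE).
have d1 := is_derive_radial (delta_mx 0 i) dF1.
have d2 : is_derive x (delta_mx 0 i) (fun z : 'rV[R]_n => z 0 j)
    ((delta_mx 0 i : 'rV[R]_n) 0 j).
  apply: is_derive_line.
  rewrite (_ : (fun h => _) =
    fun h : R => (delta_mx 0 i : 'rV[R]_n) 0 j * h + x 0 j); last first.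
    by apply/funext => h; rewrite !mxE mulrC.
  by apply: is_derive_eq; rewrite /GRing.scale /=; ring.
rewrite derive_val /GRing.scale /= dot_delta !mxE eqxx /= eq_sym.
by rewrite -mulr_natr; ring.
Unshelve. all: by end_near. Qed.

(** Here [p] stands for xi' and [p1] for xi'', and [F1], [F2] are the first two derivatives of [u]
    in [s], with dt/ds = 1/(2s). Both powers of [u] equal [expR (2 * L)] divided by an integer power
    of [u], and the rest is field algebra. *)
Lemma confA_radial (R : realType) (n : nat) (u : 'rV[R]_n -> R) (x : 'rV[R]_n)
    (L p p1 F1 F2 : R) :
  let m := (n%:R - 2) / 2 in let s := nsq x in
  0 < m -> 0 < s -> u x = expR (- m * L) ->
  grad u x = (2 * F1) *: x -> hess u x = (2 * F1)%:M + (4 * F2) *: (x^T *m x) ->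
  F1 = - m * (1 + p) / (2 * s) * u x ->
  F2 = (m ^+ 2 * (1 + p) ^+ 2 + 2 * m * (1 + p) - m * p1) / (4 * s ^+ 2) * u x ->
  confA u x = (expR (2 * L) * (1 - p ^+ 2) / (2 * s))%:M +
    (expR (2 * L) * (p1 - (1 - p ^+ 2)) / s ^+ 2) *: (x^T *m x).
Proof.
move=> m s m0 s0 uE gE hE F1E F2E.
have Nm : n%:R = 2 * m + 2 by rewrite /m; field.
have u0 : 0 < u x by rewrite uE expR_gt0.
have uP a : u x `^ a = expR (- m * L * a).
  by rewrite /powR uE gt_eqF ?expR_gt0 // expRK mulrC.
have uP1 : u x `^ (- ((n%:R + 2) / (n%:R - 2))) = expR (2 * L) / u x.
  rewrite uP uE -expRN -expRD; congr expR.
  by rewrite Nm; field; rewrite gt_eqF //=; lra.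
have uP2 : u x `^ (- (2 * n%:R / (n%:R - 2))) = expR (2 * L) / u x ^+ 2.
  rewrite uP uE -expRM_natl -expRN -expRD; congr expR.
  by rewrite Nm; field; rewrite gt_eqF //=; lra.
have gN : norm2 (grad u x) ^+ 2 = 4 * F1 ^+ 2 * s.
  rewrite gE norm2_nsq sqr_sqrtr ?nsq_ge0 // nsqZ.
  by rewrite -/s; ring.
rewrite /confA /= uP1 uP2 gN gE hE F1E F2E; apply/matrixP => i j.
rewrite !mxE !big_ord1 !mxE -[in LHS]mulr_natr -[in RHS]mulr_natr.
rewrite Nm; move: (expR _) (u x) u0 => E v v0.
case: (i == j); field; rewrite ?gt_eqF //=; lra.
Qed.

(** * The ordinary differential equation *)

Lemma primitive_continuous (R : realType) (a b : R) (g : R -> R) :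
  continuous g -> exists G : R -> R,
    forall x, a < x < b -> is_derive x 1 G (g x).
Proof.
move=> cg; exists (fun x => (\int[@lebesgue_measure R]_(t in `[a, x]) g t)%R).
move=> x /andP[ax xb].
have [] // := @continuous_FTC1_closed R g a x b xb _ ax (cg x); last first.
  by move=> d dE; apply: DeriveDef => //; rewrite -derive1E.
apply: continuous_compact_integrable; first exact: segment_compact.
exact: continuous_subspaceT.
Qed.

(** Clamping the argument extends a function from [[a, b]] to a continuous function on the whole
    line, as [primitive_continuous] demands. *)
Lemma continuous_clamp (R : realType) (a b : R) (f : R -> R) : a <= b ->
  (forall y, a <= y <= b -> {for y, continuous f}) ->
  continuous (fun y => f (Num.max a (Num.min b y))).
Proof.
move=> ab cf y; apply: (@continuous_comp _ _ _ (fun y => Num.max a (Num.min b y)) f).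
  apply: (@continuous_max R R^o (cst a) (fun y => Num.min b y)).
    exact: cst_continuous.
  apply: (@continuous_min R R^o (cst b) id); first exact: cst_continuous.
  exact: cvg_id.
by apply: cf; rewrite le_max lexx ge_max ab ge_min lexx.
Qed.

(* [y] inverts a primitive of [1 / f]; since [1 / f >= 1] the primitive
   expands distances, so [y] is defined up to time [b] and [|y t| <= |t|]. *)
Lemma autonomous_solution (R : realType) (a b : R) (f : R -> R) :
  0 < a -> 0 < b ->
  (forall y, - a <= y <= b -> {for y, continuous f}) ->
  (forall y, - a <= y <= b -> 0 < f y <= 1) ->
  exists y : R -> R, [/\ y 0 = 0,
    forall t, 0 <= t < b -> 0 <= y t <= t,
    forall t, - a < t <= 0 -> t <= y t <= 0 &
    forall t, - a < t < b -> is_derive t 1 y (f (y t))].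
Proof.
move=> a0 b0 cf f01.
have ab : - a <= b by lra.
pose g y := (f (Num.max (- a) (Num.min b y)))^-1.
have cg : continuous g.
  move=> y; apply: continuousV; last exact: continuous_clamp.
  by rewrite gt_eqF // (andP (f01 _ _)).1 // le_max lexx ge_max ab ge_min lexx.
(* The interval is enlarged by 1 on each side so that the endpoints [- a] and [b] are interior to
   it. *)
have [G0 dG0] := @primitive_continuous R (- a - 1) (b + 1) g cg.
pose G y := G0 y - G0 0.
have dG y : - a <= y <= b -> is_derive y 1 G (f y)^-1.
  move=> yab; rewrite /G -[(f y)^-1]subr0; apply: is_deriveB.
  have := dG0 y; rewrite /g min_r ?max_r; first by apply; lra.
  - by case/andP: yab.
  - by case/andP: yab.
have cG x y : - a <= x -> y <= b -> {within `[x, y], continuous G}.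
  move=> ax yb; apply: derivable_within_continuous => z.
  rewrite in_itv /= => /andP[xz zy].
  by have [] := dG z ltac:(lra).
have expG x y : - a <= x -> x <= y -> y <= b -> y - x <= G y - G x.
  move=> ax xy yb.
  have [z|z] := @MVT_segment R G (fun z => (f z)^-1) x y xy _ (cG _ _ ax yb).
    by rewrite in_itv /= => /andP[xz zy]; apply: dG; lra.
  rewrite in_itv /= => /andP[xz zy] ->.
  have /andP[fz0 fz1] := f01 z ltac:(lra).
  by rewrite ler_peMl ?subr_ge0 // invf_ge1.
have G00 : G 0 = 0 by rewrite /G subrr.
have injG x y : - a <= x <= b -> - a <= y <= b -> G x = G y -> x = y.
  move=> xab yab e; case: (leP x y) => xy.
    by have := expG x y ltac:(lra) xy ltac:(lra); lra.
  by have := expG y x ltac:(lra) ltac:(lra) ltac:(lra); lra.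
pose Y t := xget 0 [set z | - a <= z <= b /\ G z = t].
have GK z : - a <= z <= b -> Y (G z) = z.
  move=> zab; rewrite /Y; case: xgetP => [z' _ [z'ab e]|/(_ z)]; last by case.
  exact: injG.
have Ypos t : 0 <= t < b -> (0 <= Y t <= t) /\ G (Y t) = t.
  move=> /andP[t0 tb].
  have Gt := expG 0 t ltac:(lra) t0 ltac:(lra).
  (* Expansion gives [t <= G t], so [t] is already attained on [[0, t]]; this yields both existence
     and the bound [Y t <= t]. Negative times are symmetric. *)
  have [||z zt <-] := @IVT R G 0 t t t0.
  - by apply: cG; lra.
  - by rewrite ge_min le_max; apply/andP; split; apply/orP; [left|right]; lra.
  - move: zt; rewrite in_itv /= => /andP[z0 zt].
    have zz := expG 0 z ltac:(lra) ltac:(lra) ltac:(lra).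
    by rewrite GK; [split => //|]; lra.
have Yneg t : - a < t <= 0 -> (t <= Y t <= 0) /\ G (Y t) = t.
  move=> /andP[ta t0].
  have Gt := expG t 0 ltac:(lra) t0 ltac:(lra).
  have [||z zt <-] := @IVT R G t 0 t t0.
  - by apply: cG; lra.
  - by rewrite ge_min le_max; apply/andP; split; apply/orP; [left|right]; lra.
  - move: zt; rewrite in_itv /= => /andP[z0 zt].
    have zz := expG z 0 ltac:(lra) ltac:(lra) ltac:(lra).
    by rewrite GK; [split => //|]; lra.
exists Y; split.
- by rewrite -{1}G00 GK //; lra.
- by move=> t /Ypos[].
- by move=> t /Yneg[].
move=> t tab.
have [Yt Gt] : - a < Y t < b /\ G (Y t) = t.
  case: (leP 0 t) => t0.
    by have [? ?] := Ypos t ltac:(lra); split => //; lra.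
  by have [? ?] := Yneg t ltac:(lra); split => //; lra.
have nY : \forall z \near Y t, - a < z < b.
  near=> z; apply/andP; split; near: z.
    by apply: lt_nbhsr; lra.
  by apply: lt_nbhsl; lra.
rewrite -[X in is_derive X]Gt -[f _]invrK.
apply: is_derive_inverse.
- by apply: filterS nY => z zab; apply: GK; lra.
- apply: filterS nY => z zab.
  have [d _] := dG z ltac:(lra).
  exact/differentiable_continuous/derivable1_diffP.
- by apply: dG; lra.
- by rewrite invr_eq0 gt_eqF //; have /andP[] := f01 (Y t) ltac:(lra).
Unshelve. all: by end_near. Qed.

(* The height [h] does not depend on [e] and [A]; this makes the outer radius
   common to the whole family. *)
Lemma small_time (R : realType) (q N A1 theta : R) :
  0 < N -> 0 < A1 -> 0 < theta -> exists h e0 : R, [/\ 0 < h, 0 < e0 &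
    forall e A y, 0 < e <= e0 -> 0 < A <= A1 -> 0 <= y <= h ->
      0 < A * expR ((N - q) * y) + (e - A) * expR (- q * y) < theta].
Proof.
move=> N0 A10 th0.
pose E : R := expR `|q|.
have E0 : 0 < E by exact: expR_gt0.
(* The bound 1 gives [expR (- q * y) <= E]; the bound [1 / (2 * N)] gives
   [expR (N * y) - 1 <= 2 * N * h]; the third keeps the term in [A] below [theta / (4 * E)]. The
   term in [e] gets the same share, for a total of at most [theta / 2]. *)
pose h := Num.min 1 (Num.min (1 / (2 * N)) (theta / (8 * E * A1 * N))).
have hh : [/\ 0 < h, h <= 1, h <= 1 / (2 * N) & h <= theta / (8 * E * A1 * N)].
  by rewrite /h !lt_min !ge_min !lexx !orbT /= ltr01 !divr_gt0 ?mulr_gt0.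
case: hh => h0 h1 hN hth.
exists h, (theta / (4 * E)); split=> //; first by rewrite divr_gt0 ?mulr_gt0.
move=> e A y /andP[e0 eth] /andP[A0 AA1] /andP[y0 yh].
rewrite mulrBl expRD.
have -> : A * (expR (N * y) * expR (- (q * y))) + (e - A) * expR (- q * y) =
    expR (- q * y) * (e + A * (expR (N * y) - 1)) by rewrite mulNr; ring.
have Ny0 : 0 <= N * y by rewrite mulr_ge0 // ltW.
have eN1 : 1 <= expR (N * y) by rewrite -[X in X <= _]expR0 ler_expR.
have qE : expR (- q * y) <= E.
  rewrite ler_expR (le_trans (ler_norm _)) // normrM normrN (ger0_norm y0).
  by rewrite ler_piMr // (le_trans yh).
have eN2 : expR (N * y) - 1 <= 2 * N * h.
  have Nh : N * h <= 1 / 2.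
    by rewrite mulrC -ler_pdivlMr // (le_trans hN) // !mul1r invfM.
  have Ny : N * y <= N * h by rewrite ler_pM2l.
  have := expR_ge1Dx (- (N * y)); rewrite expRN => e1.
  have X0 := expR_gt0 (N * y).
  have : (1 - N * y) * expR (N * y) <= 1.
    by rewrite -ler_pdivlMr // div1r.
  by nra.
have B : 2 * N * h * A <= theta / (4 * E).
  have : h * (N * A1) <= theta / (8 * E).
    rewrite -ler_pdivlMr ?mulr_gt0 // (le_trans hth) //.
    by rewrite le_eqVlt; apply/orP; left; apply/eqP; field; rewrite !gt_eqF.
  have -> : theta / (4 * E) = 2 * (theta / (8 * E)).
    by field; rewrite gt_eqF.
  have : h * (N * A) <= h * (N * A1) by rewrite !ler_pM2l.
  by lra.
have X : A * (expR (N * y) - 1) <= 2 * N * h * A.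
  by rewrite mulrC ler_wpM2r // ltW.
have X0 : 0 <= A * (expR (N * y) - 1) by rewrite mulr_ge0 ?subr_ge0 // ltW.
apply/andP; split; first by rewrite mulr_gt0 ?expR_gt0 // ltr_wpDr.
have := expR_gt0 (- q * y); set Q := expR (- q * y) in qE * => Q0.
apply: (@le_lt_trans _ _ (E * (theta / (4 * E) + theta / (4 * E)))).
  by apply: ler_pM; lra.
have -> : E * (theta / (4 * E) + theta / (4 * E)) = theta / 2.
  by field; rewrite gt_eqF.
by lra.
Qed.

(* [w] is the k-th power of [S = (1 - p ^+ 2) / 2]: in the ODE of the header,
   [S ^+ k] solves a linear first-order equation as a function of [y], with
   value [e ^+ k] at [y = 0]. The resulting first integral leaves the autonomous
   equation [y' = Num.sqrt (1 - 2 * S y)]. *)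
Lemma profile (R : realType) (k : nat) (q N A e h : R) :
  let w y := A * expR ((N - q) * y) + (e ^+ k.+1 - A) * expR (- q * y) in
  N - q = 2 * k.+1%:R -> 0 < e -> 0 < h ->
  (forall y : R, 0 <= y <= h -> 0 < w y < (1 / 4) ^+ k.+1) ->
  exists (d : R) (y p : R -> R), [/\ 0 < d, y 0 = 0, p 0 = - Num.sqrt (1 - 2 * e),
    forall t, 0 <= t < h -> 0 <= y t <= t &
    forall t : R, - d < t < h -> [/\ -1 < p t < 0,
      is_derive t 1 y (- p t) &
      is_derive t 1 p (N * A / k.+1%:R * expR ((N - q) * y t)
          * (2 / (1 - p t ^+ 2)) ^+ k - q / k.+1%:R * ((1 - p t ^+ 2) / 2))]].
Proof.
move=> w Nq e0 h0 wP.
have k0 : 0 < k.+1%:R :> R by rewrite ltr0n.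
have dw (y : R) : is_derive y 1 w (N * A * expR ((N - q) * y) - q * w y).
  by rewrite /w; apply: is_derive_eq; rewrite /GRing.scale /=; ring.
have cw : continuous w.
  move=> y; have [d _] := dw y.
  exact/differentiable_continuous/derivable1_diffP.
(* Continuity at 0 extends the bounds to slightly negative [y], so that the solution will be defined
   across the unit sphere. *)
have [d d0 wd] : exists2 d : R, 0 < d &
    forall y, - d <= y <= h -> 0 < w y < (1 / 4) ^+ k.+1.
  have nw : \forall y \near (0 : R), 0 < w y < (1 / 4) ^+ k.+1.
    have /andP[w0 w1] := wP 0 ltac:(lra).
    have c0 : w @ (0 : R) --> w 0 by exact: cw.
    near=> z; apply/andP; split; near: z.
      by apply: (cvgr_gt _ c0).
    by apply: (cvgr_lt _ c0).
  have [d /= d0 dP] := nw.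
  exists (d / 2) => [|y yd]; first by lra.
  case: (leP 0 y) => y0; first by apply: wP; lra.
  by apply: dP; rewrite /= sub0r normrN ltr_norml; lra.
(* The index is shifted: [k.+1] is the k of the header, so [S] is the root of order [k.+1] of [w].
   The bound on [w] means [S < 1 / 4], which keeps the square root in [f] away from 0. *)
pose S y := expR (ln (w y) / k.+1%:R).
have S0 y : 0 < S y by exact: expR_gt0.
have SX y : 0 < w y -> S y ^+ k.+1 = w y.
  by move=> w0; rewrite /S -expRM_natl mulrC divfK ?gt_eqF // lnK.
have S4 y : - d <= y <= h -> S y < 1 / 4.
  move=> /wd /andP[w0 w1].
  by rewrite -(@ltr_pXn2r _ k.+1) ?nnegrE ?SX // ltW.
have dS (y : R) : - d <= y <= h ->
    is_derive y 1 S (S y * ((N * A * expR ((N - q) * y) - q * w y) / (k.+1%:R * w y))).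
  move=> /wd /andP[w0 w1].
  have dwy := dw y; have dln := is_derive1_ln w0.
  have dlw := @is_derive1_comp _ _ _ _ _ _ dln dwy.
  rewrite (_ : S = expR \o (fun y : R => k.+1%:R^-1 * (@ln R \o w) y)); last first.
    by apply/funext => z; rewrite /S /= mulrC.
  apply: is_derive_eq; rewrite /= /S (mulrC (k.+1%:R^-1)).
  by rewrite /GRing.scale /=; field; rewrite !gt_eqF.
pose f y := Num.sqrt (1 - 2 * S y).
have fX y : - d <= y <= h -> f y ^+ 2 = 1 - 2 * S y.
  by move=> /S4 s4; rewrite sqr_sqrtr //; lra.
have f0 y : - d <= y <= h -> 0 < f y.
  by move=> /S4 s4; rewrite sqrtr_gt0; lra.
have f1 y : - d <= y <= h -> f y < 1.
  by move=> yd; have := fX y yd; have := f0 y yd; have := S0 y; nra.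
have df (y : R) : - d <= y <= h -> is_derive y 1 f
    (- (S y * ((N * A * expR ((N - q) * y) - q * w y) / (k.+1%:R * w y))) / f y).
  move=> yd; have s4 := S4 y yd; have fy := f0 y yd; have dSy := dS y yd.
  have p0 : 0 < 1 - 2 * S y by lra.
  have dq := is_derive1_sqrt p0.
  have dl : is_derive y 1 (fun y : R => 1 - 2 * S y)
     (- 2 * (S y * ((N * A * expR ((N - q) * y) - q * w y) / (k.+1%:R * w y)))).
    by apply: is_derive_eq; rewrite /GRing.scale /=; ring.
  have dc : is_derive y 1 f _ :=
    @is_derive1_comp _ Num.sqrt (fun y => 1 - 2 * S y) _ _ _ dq dl.
  apply: (is_derive_eq dc).
  rewrite -/(f y); set X := S y * _.
  by field; rewrite gt_eqF.
have cf (y : R) : - d <= y <= h -> {for y, continuous f}.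
  move=> yd; have [c _] := df y yd.
  exact/differentiable_continuous/derivable1_diffP.
have [|y [y00 ypos yneg dy]] := @autonomous_solution R d h f d0 h0 cf.
  by move=> y yd; rewrite f0 // ltW // f1.
exists d, y, (fun t => - f (y t)); split => //.
  rewrite y00; congr (- Num.sqrt (1 - 2 * _)).
  apply/eqP; rewrite -(@eqrXn2 _ k.+1) //; [|exact: ltW..].
  have w0 : w 0 = e ^+ k.+1 by rewrite /w !mulr0 expR0; ring.
  by rewrite SX w0 // exprn_gt0.
move=> t td.
have yd : - d <= y t <= h.
  case: (leP 0 t) => t0.
    by have := ypos t ltac:(lra); lra.
  by have := yneg t ltac:(lra); lra.
have dyt := dy t td; have dfy := df _ yd.
have fy0 := f0 _ yd; have fy1 := f1 _ yd; have Sy0 := S0 (y t).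
split; [lra|by rewrite opprK|].
have dc := @is_derive1_comp _ f y t _ _ dfy dyt.
rewrite (_ : (fun t => _) = - (f \o y)) //.
apply: (is_derive_eq (is_deriveN dc)).
(* Substituting 1 - p^2 = 2S and w = S^(k+1) into the derivative of [- f (y t)] recovers the
   second-order equation. *)
have e1 : 1 - (- f (y t)) ^+ 2 = 2 * S (y t).
  by rewrite sqrrN fX //; ring.
have /andP[w0 _] := wd _ yd.
rewrite e1 -(SX _ w0) exprS.
have Sk0 : 0 < S (y t) ^+ k by rewrite exprn_gt0.
have -> : 2 / (2 * S (y t)) = (S (y t))^-1 by field; rewrite gt_eqF.
have -> : 2 * S (y t) / 2 = S (y t) by field.
rewrite exprVn.
by field; rewrite !gt_eqF.
Unshelve. all: by end_near. Qed.

(** * From the profile to a radial solution *)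

(* [E * S] is the eigenvalue of multiplicity [n - 1] and [E * (p1 - S)] the
   simple one, in the radial direction. *)
Lemma sigma_profile (R : realType) (n k j : nat) (E S W p1 : R) :
  let f j := 'C(n.-1, j)%:R * (E * S) ^+ j +
    'C(n.-1, j.-1)%:R * (E * (p1 - S)) * (E * S) ^+ j.-1 in
  (1 <= j <= k)%N -> (k <= n)%N -> 0 < E -> 0 < S -> 0 < W ->
  p1 = W - (n%:R - 2 * k%:R) / k%:R * S ->
  0 < f j /\ f k = 'C(n.-1, k.-1)%:R * E ^+ k * S ^+ k.-1 * W.
Proof.
move=> f /andP[j1 jk] kn E0 S0 W0 p1E.
(* The ratio C(n-1, i) = (n-i)/i C(n-1, i-1) merges the two terms. *)
have fE i : (1 <= i <= n)%N -> f i = 'C(n.-1, i.-1)%:R * E ^+ i * S ^+ i.-1 *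
    (p1 + (n%:R - 2 * i%:R) / i%:R * S).
  case: i n {kn p1E} @f => [|i] [|n] // f; rewrite ltnS /= => iN.
  have i0 : i.+1%:R != 0 :> R by rewrite pnatr_eq0.
  rewrite /f /=; have -> : 'C(n, i.+1)%:R = (n%:R - i%:R) * 'C(n, i)%:R / i.+1%:R :> R.
    by rewrite -natrB // -natrM -mul_bin_left natrM mulrC mulKf.
  rewrite !exprMn !exprS -!natr1; rewrite -natr1 in i0.
  by field.
have jn : (j <= n)%N := leq_trans jk kn.
have j0 : 0 < j%:R :> R by rewrite ltr0n.
have k0 : 0 < k%:R :> R by rewrite ltr0n (leq_trans j1 jk).
have b0 : 0 < 'C(n.-1, j.-1)%:R :> R.
  by rewrite ltr0n bin_gt0; case: n j j1 jn {jk p1E kn f fE j0} => [|n] [|j].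
split; last first.
  rewrite fE ?kn ?(leq_trans j1 jk) //; congr (_ * _).
  by rewrite p1E subrK.
rewrite fE ?j1 ?jn // p1E.
(* Since 1/j >= 1/k for j <= k, the last term is nonnegative: solving the equation of order [k] puts
   the eigenvalues in the whole cone. *)
have -> : W - (n%:R - 2 * k%:R) / k%:R * S + (n%:R - 2 * j%:R) / j%:R * S =
    W + n%:R * S * (j%:R^-1 - k%:R^-1) by field; rewrite !gt_eqF.
rewrite !mulr_gt0 ?exprn_gt0 // ltr_wpDr // mulr_ge0 ?mulr_ge0 ?ler0n //.
  exact: ltW.
by rewrite subr_ge0 lef_pV2 ?posrE // ler_nat.
Qed.

Ltac gen_alg_tac :=
  repeat first [assumption | apply: gen_alg_cst | apply: gen_algD
    | apply: gen_algM | apply: gen_algX].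

(** [J] is the range of s = exp(2t) for t in (-d, h), and the hypothesis on [B] normalises [sigma]
    to 1. Smoothness comes from the equation itself, which expresses p' as a polynomial in [p], [V]
    and [Z]. *)
Lemma radial_solution (R : realType) (n k : nat) (B d h xi0 : R)
    (y p : R -> R) :
  let m : R := (n%:R - 2) / 2 in
  let t s : R := ln s / 2 in
  let p1 t := B * expR (2 * k.+1%:R * y t) * (2 / (1 - p t ^+ 2)) ^+ k
     - (n%:R - 2 * k.+1%:R) / k.+1%:R * ((1 - p t ^+ 2) / 2) in
  let L t := t + xi0 - y t in
  let J := [set s : R | expR (- 2 * d) < s < expR (2 * h)] in
  let F s := expR (- m * L (t s)) in
  let u := F \o @nsq R n in
  0 < m -> (k < n)%N -> B * 'C(n.-1, k)%:R * expR (2 * k.+1%:R * xi0) = 1 ->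
  (forall t : R, - d < t < h -> [/\ -1 < p t < 0, is_derive t 1 y (- p t) &
     is_derive t 1 p (p1 t)]) ->
  [/\ open (@nsq R n @^-1` J), smooth_on (@nsq R n @^-1` J) u &
    forall x, J (nsq x) -> let s := nsq x in let q := p (t s) in
    [/\ sigma k.+1 (eigvals (confA u x)) = 1,
        Gamma_cone k.+1 (eigvals (confA u x)),
        is_derive s 1 F (- m * (1 + q) / (2 * s) * u x) &
        hess u x = (2 * (- m * (1 + q) / (2 * s) * u x))%:M +
          (4 * ((m ^+ 2 * (1 + q) ^+ 2 + 2 * m * (1 + q) - m * p1 (t s)) /
             (4 * s ^+ 2) * u x)) *: (x^T *m x)]].
Proof.
move=> m t p1 L J F u m0 kn BE yp.
have oJ : open J.
  have -> : J = `]expR (- 2 * d), expR (2 * h)[%classic.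
    by apply/seteqP; split => s; rewrite /= in_itv.
  exact: interval_open.
have J0 s : J s -> 0 < s by case/andP => s0 _; apply: lt_trans s0; exact: expR_gt0.
have tJ s : J s -> - d < t s < h.
  move=> Js; have s0 := J0 s Js; case/andP: Js.
  rewrite -{1 2}(lnK s0) !ltr_expR /t; lra.
have dt s : J s -> is_derive s 1 t (s^-1 * 2^-1).
  move=> /J0 s0; have dl := is_derive1_ln s0.
  rewrite (_ : t = fun s => 2^-1 * ln s); last by apply/funext => z; rewrite mulrC.
  by apply: is_derive_eq; rewrite /GRing.scale /= mulrC.
have dy s : J s -> is_derive s 1 (y \o t) (- p (t s) * (s^-1 * 2^-1)).
  move=> Js; have [_ d1 _] := yp _ (tJ _ Js); have d2 := dt _ Js.
  exact: is_derive1_comp.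
have dp s : J s -> is_derive s 1 (p \o t) (p1 (t s) * (s^-1 * 2^-1)).
  move=> Js; have [_ _ d1] := yp _ (tJ _ Js); have d2 := dt _ Js.
  exact: is_derive1_comp.
have p01 s : J s -> 0 < 1 - p (t s) ^+ 2.
  by move=> Js; have [/andP[? ?] _ _] := yp _ (tJ _ Js); nra.
pose i s : R := s^-1.
pose V s := 2 / (1 - (p \o t) s ^+ 2).
pose Z s := expR (2 * k.+1%:R * (y \o t) s).
have di s : J s -> is_derive s 1 i (- (i s * i s)).
  move=> /J0 s0; have s1 : (@id R) s != 0 by rewrite gt_eqF.
  apply: (is_derive_eq (is_deriveV s1 (is_derive_id s 1))).
  by rewrite /GRing.scale /= mulr1 /i expr2 invfM.
have dF s : J s -> is_derive s 1 F (F s * ((- m * (1 + (p \o t) s)) * (i s * 2^-1))).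
  move=> Js; have d1 := dy _ Js; have d2 := dt _ Js.
  rewrite (_ : F = expR \o (fun s => - m * (t s + xi0 - (y \o t) s))) //.
  apply: is_derive_eq; rewrite /GRing.scale /= /F /L /i; ring.
have dZ s : J s -> is_derive s 1 Z
    (Z s * ((2 * k.+1%:R * - 1 * (p \o t) s) * (i s * 2^-1))).
  move=> Js; have d1 := dy _ Js.
  rewrite (_ : Z = expR \o (fun s => 2 * k.+1%:R * (y \o t) s)) //.
  apply: is_derive_eq; rewrite /GRing.scale /= /Z /i /=; ring.
have dV s : J s -> is_derive s 1 V
    ((p \o t) s * (V s * V s) * (p1 (t s) * (i s * 2^-1))).
  move=> Js; have d1 := dp _ Js; have q0 := p01 _ Js.
  have q1 : (fun s => 1 - (p \o t) s ^+ 2) s != 0 by rewrite gt_eqF.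
  have d2 : is_derive s 1 (fun s => 1 - (p \o t) s ^+ 2)
      (- (2 * p (t s) * (p1 (t s) * (s^-1 * 2^-1)))).
    by apply: is_derive_eq; rewrite /GRing.scale /=; ring.
  have d3 := @is_deriveV _ (fun s => 1 - (p \o t) s ^+ 2) _ _ _ q1 d2.
  rewrite (_ : V = fun s => 2 * (1 - (p \o t) s ^+ 2)^-1) //.
  apply: is_derive_eq; rewrite /GRing.scale /= /i.
  by field; rewrite !gt_eqF // J0.
(* These five functions generate an algebra closed under d/ds; [i] accounts for dt/ds, and [V] is
   the reciprocal of S. *)
pose G := [set f : R -> R | f = i \/ [\/ f = F, f = p \o t, f = V | f = Z]].
have Gi : gen_alg G i by apply: gen_alg_gen; left.
have GF : gen_alg G F by apply: gen_alg_gen; right; constructor 1.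
have Gp : gen_alg G (p \o t) by apply: gen_alg_gen; right; constructor 2.
have GV : gen_alg G V by apply: gen_alg_gen; right; constructor 3.
have GZ : gen_alg G Z by apply: gen_alg_gen; right; constructor 4.
have Gp1 : gen_alg G (p1 \o t).
  have -> : p1 \o t = fun s => B * Z s * V s ^+ k +
      (- ((n%:R - 2 * k.+1%:R) / k.+1%:R)) * ((1 + (-1) * (p \o t) s ^+ 2) * 2^-1).
    by apply/funext => s; rewrite /p1 /= !mulN1r mulNr.
  by gen_alg_tac.
split.
- by apply: open_comp => // x _; exact: continuous_nsq.
- apply: (@smooth_on_radial _ _ J G) => //; last by right; constructor 1.
  move=> f [->|[->|->|->|->]].
  + exists (fun s => -1 * (i s * i s)) => [|s /di]; last by rewrite mulN1r.
    by gen_alg_tac.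
  + exists (fun s => F s * ((- m * (1 + (p \o t) s)) * (i s * 2^-1))) => //.
    by gen_alg_tac.
  + exists (fun s => (p1 \o t) s * (i s * 2^-1)) => //.
    by gen_alg_tac.
  + exists (fun s => (p \o t) s * (V s * V s) * ((p1 \o t) s * (i s * 2^-1))) => //.
    by gen_alg_tac.
  + exists (fun s => Z s * ((2 * k.+1%:R * - 1 * (p \o t) s) * (i s * 2^-1))) => //.
    by gen_alg_tac.
move=> x Jx s q.
have s0 : 0 < s := J0 _ Jx.
have dFs z : J z -> is_derive z 1 F (- m * (1 + p (t z)) / (2 * z) * F z).
  move=> Jz; apply: (is_derive_eq (dF z Jz)); rewrite /i /=.
  by field; rewrite gt_eqF // J0.
pose F1 z := - m * (1 + p (t z)) / (2 * z) * F z.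
pose F2 := (m ^+ 2 * (1 + q) ^+ 2 + 2 * m * (1 + q) - m * p1 (t s)) /
             (4 * s ^+ 2) * u x.
have dF1 : is_derive s 1 F1 F2.
  have d1 := dF _ Jx; have d2 := di _ Jx; have d3 := dp _ Jx.
  rewrite (_ : F1 = fun z => - m / 2 * (1 + (p \o t) z) * i z * F z); last first.
    by apply/funext => z; rewrite /F1 /i /= invfM; ring.
  apply: is_derive_eq; rewrite /GRing.scale /= /F2 /i /u /= -/s -/q.
  by field; rewrite gt_eqF.
have hE : hess u x = (2 * F1 s)%:M + (4 * F2) *: (x^T *m x).
  exact: (hess_radial oJ Jx dFs dF1).
have gE : grad u x = (2 * F1 s) *: x := grad_radial (dFs _ Jx).
have cE := @confA_radial R n u x (L (t s)) q (p1 (t s)) (F1 s) F2 m0 s0 erefl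
  gE hE erefl erefl.
pose E := expR (2 * (xi0 - y (t s))).
(* Since exp(2t) = s, the factor [s] cancels the division by [s] in the eigenvalues, leaving [E] =
   exp(2 xi). *)
have EE : expR (2 * L (t s)) = s * E.
  rewrite /L -addrA mulrDr expRD /t (mulrC 2 (_ / _)) divfK ?pnatr_eq0 //.
  by rewrite lnK.
pose S := (1 - q ^+ 2) / 2.
pose W := B * expR (2 * k.+1%:R * y (t s)) * (2 / (1 - q ^+ 2)) ^+ k.
have q0 := p01 _ Jx; rewrite -/s -/q in q0.
have S0 : 0 < S by rewrite /S divr_gt0.
have C0 : 0 < 'C(n.-1, k)%:R :> R.
  by rewrite ltr0n bin_gt0 -ltnS (ltn_predK kn).
have B0 : 0 < B.
  have : 0 < B * ('C(n.-1, k)%:R * expR (2 * k.+1%:R * xi0)) by rewrite mulrA BE.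
  by rewrite pmulr_lgt0 // mulr_gt0 ?expR_gt0.
have W0 : 0 < W by rewrite !mulr_gt0 ?expR_gt0 // exprn_gt0 // divr_gt0.
have E0 : 0 < E by exact: expR_gt0.
have sE j : (1 <= j <= n)%N -> sigma j (eigvals (confA u x)) =
    'C(n.-1, j)%:R * (E * S) ^+ j +
    'C(n.-1, j.-1)%:R * (E * (p1 (t s) - S)) * (E * S) ^+ j.-1.
  move=> jn; rewrite cE sigma_eigvals_scalar_rank1 // -/(nsq x) -/s EE.
  congr (_ * _ ^+ _ + _ * _ * _ ^+ _); rewrite /S; field; exact: lt0r_neq0.
have pE : p1 (t s) = W - (n%:R - 2 * k.+1%:R) / k.+1%:R * S by [].
split.
- rewrite sE ?kn //.
  have [_ ->] := @sigma_profile R n k.+1 k.+1 E S W (p1 (t s)) ltac:(by rewrite leqnn) kn E0 S0 W0 pE.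
  rewrite /= /W; have -> : 2 / (1 - q ^+ 2) = S^-1 by rewrite /S invfM invrK mulrC.
  have Sk : S ^+ k != 0 by rewrite expf_neq0 // gt_eqF.
  rewrite exprVn -[RHS]BE.
  have -> : expR (2 * k.+1%:R * xi0) = E ^+ k.+1 * expR (2 * k.+1%:R * y (t s)).
    by rewrite /E -expRM_natl -expRD; congr expR; ring.
  by field.
- move=> j /andP[j1 jk]; rewrite sE ?j1 ?(leq_trans jk) //.
  by have [] := @sigma_profile R n k.+1 j E S W (p1 (t s)) ltac:(by rewrite j1) kn E0 S0 W0 pE.
- exact: dFs Jx.
- exact: hE.
Qed.

(** * Uniform bounds and blow-up *)

(** The Hessian is bounded below through its trace, the Laplacian, which is explicit for radial
    functions. *)
Lemma norm_trace_le (R : realType) (n : nat) (M : 'M[R]_n) :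
  `|\tr M| <= n%:R * norm2 M.
Proof.
rewrite /mxtrace (le_trans (ler_norm_sum _ _ _)) //.
rewrite mulr_natl -[X in _ *+ X](card_ord n) -sumr_const; apply: ler_sum => i _.
rewrite -sqrtr_sqr ler_wsqrtr // (bigD1 i) //= (bigD1 i) //= -addrA lerDl.
by rewrite addr_ge0 //; do 2?[apply: sumr_ge0 => *]; rewrite ?sqr_ge0.
Qed.

Lemma mxtrace_scalar_rank1 (R : realType) (n : nat) (a b : R) (x : 'rV[R]_n) :
  \tr (a%:M + b *: (x^T *m x)) = n%:R * a + b * nsq x.
Proof.
by rewrite linearD /= linearZ /= mxtrace_scalar mxtrace_mulC trace_mx11 mulr_natl.
Qed.

(** All constants are fixed before [e]. The blow-up rate is kept only as [M0 / e], weaker than the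
    true order but enough for the limit. *)
Lemma solution_family (R : realType) (n k : nat) (c : R) :
  (3 <= n)%N -> (1 <= k)%N -> (k < n)%N -> c < 0 ->
  exists C0 R0 e0 M0 M1 : R, [/\ 0 < C0, 1 < R0, 0 < e0, 0 < M0 &
    forall e, 0 < e <= e0 -> exists u : 'rV[R]_n -> R,
    [/\ [/\ smooth_upto (ecball n R0 `\` eball n 1) u,
              (forall x, (eball n R0 `\` eball n 1) x ->
                 sigma k.+1 (eigvals (confA u x)) = 1),
              (forall x, (ecball n R0 `\` eball n 1) x ->
                 0 < u x /\ Gamma_cone k.+1 (eigvals (confA u x))),
              (forall x, esphere n 1 x ->
                 radial_deriv u x + (n%:R - 2) / 2 * u x =
                 - ((n%:R - 2) / 2 * c * u x `^ (n%:R / (n%:R - 2)))) &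
              (forall x, (eball n R0 `\` eball n 1) x ->
                 `|u x| + `|(u x)^-1| + norm2 (grad u x) <= C0)] &
      forall x, esphere n 1 x -> M0 / e - M1 <= norm2 (hess u x)]].
Proof.
move=> n3 k1 kn c0.
pose N : R := n%:R; pose K : R := k.+1%:R; pose m : R := (N - 2) / 2.
pose a : R := 'C(n.-1, k)%:R; pose q := N - 2 * K.
have N3 : 3 <= N by rewrite /N -[3]/(3%:R) ler_nat.
have m0 : 0 < m by rewrite /m; lra.
have K1 : 1 <= K by rewrite /K -[1]/(1%:R) ler_nat.
have K0 : 0 < K by lra.
have a0 : 0 < a by rewrite ltr0n bin_gt0 -ltnS (ltn_predK kn).
(* The value of [A] for which [N * A / K] meets the normalisation in [radial_solution] when xi(0) =
   [x]. *)
pose A0 x : R := K / (a * N) * expR (- (2 * K * x)).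
have A00 x : 0 < A0 x.
  by rewrite /A0 mulr_gt0 ?expR_gt0 // divr_gt0 ?mulr_gt0 //; lra.
have th0 : 0 < (1 / 4 : R) ^+ k.+1 by rewrite exprn_gt0.
have N0 : 0 < N by lra.
have [h [e1 [h0 e10 st]]] := small_time q N0 (A00 (ln (- c))) th0.
pose M := `|ln (- c)| + `|ln (- (2 * c))| + h.
pose U0 := expR (- m * M); pose U1 := expR (m * M).
pose B0 : R := a^-1 * expR (- (2 * K * ln (- (2 * c)))).
have B00 : 0 < B0 by rewrite mulr_gt0 ?invr_gt0 ?expR_gt0.
(* [u] and its inverse are at most [U1], the gradient at most [m * U1]. The outer radius gives t <=
   h/2, strictly inside the time interval. With [e <= 1 / 4] one has 1/2 < r < 1, so [xi0] lies
   between [ln (- c)] and [ln (- (2 * c))]. *)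
exists ((2 + m) * U1), (expR (h / 2)), (Num.min (1 / 4) e1),
  (U0 * m * B0 / N), (U1 * m * N / N).
split.
- by rewrite mulr_gt0 ?expR_gt0 //; lra.
- by rewrite -[X in X < _]expR0 ltr_expR; lra.
- by rewrite lt_min e10; lra.
- by rewrite divr_gt0 // mulr_gt0 // mulr_gt0 // expR_gt0.
move=> e /andP[e0]; rewrite le_min => /andP[e4 ee1].
pose r := Num.sqrt (1 - 2 * e).
have r2 : r ^+ 2 = 1 - 2 * e by rewrite sqr_sqrtr //; lra.
have r0 : 0 < r by rewrite sqrtr_gt0; lra.
have r1 : r < 1 by rewrite -sqrtr1 ltr_sqrt //; lra.
have r12 : 1 / 2 < r.
  by rewrite -(@ltr_pXn2r _ 2) ?nnegrE ?r2 ?(ltW r0) //; lra.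
(* Solves the boundary condition - r = c exp(- xi0). *)
pose xi0 := ln (- c / r).
have cr0 : 0 < - c / r by rewrite divr_gt0 // oppr_gt0.
have xi1 : ln (- c) <= xi0.
  rewrite ler_ln ?posrE ?oppr_gt0 // ler_pdivlMr //.
  by rewrite ler_piMr ?oppr_ge0 ?(ltW c0) ?(ltW r1).
have xi2 : xi0 <= ln (- (2 * c)).
  rewrite ler_ln ?posrE //; last by lra.
  by rewrite ler_pdivrMr //; nra.
have exi : expR (- xi0) = r / - c by rewrite expRN lnK // invf_div.
pose A := A0 xi0.
have AA1 : A <= A0 (ln (- c)).
  rewrite ler_pM2l ?divr_gt0 ?mulr_gt0 //.
  by rewrite ler_expR lerN2 ler_pM2l //; lra.
have Nq : N - q = 2 * K by rewrite /q; ring.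
have wP (y : R) : 0 <= y <= h ->
    0 < A * expR ((N - q) * y) + (e ^+ k.+1 - A) * expR (- q * y) < (1 / 4) ^+ k.+1.
  move=> yh; apply: st => //; last by rewrite A00.
  rewrite exprn_gt0 //= (le_trans _ ee1) // exprS ler_piMr ?(ltW e0) //.
  by rewrite exprn_ile1 ?(ltW e0) //; lra.
have [d [y [p [d0 y0 p0 yt yp]]]] := profile Nq e0 h0 wP.
pose B := N * A / K.
have BE : B * a * expR (2 * K * xi0) = 1.
  rewrite /B /A /A0 expRN; field; rewrite !gt_eqF ?expR_gt0 //; lra.
rewrite Nq in yp.
pose t (s : R) : R := ln s / 2.
pose p1 t := B * expR (2 * K * y t) * (2 / (1 - p t ^+ 2)) ^+ k -
  q / K * ((1 - p t ^+ 2) / 2).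
pose F s := expR (- m * (t s + xi0 - y (t s))).
pose u := F \o @nsq R n.
pose F1 x := - m * (1 + p (t (nsq x))) / (2 * nsq x) * u x.
have [oU sU _] := radial_solution m0 kn BE yp.
have uP (x : 'rV[R]_n) : expR (- 2 * d) < nsq x < expR (2 * h) ->
    [/\ sigma k.+1 (eigvals (confA u x)) = 1,
        Gamma_cone k.+1 (eigvals (confA u x)),
        is_derive (nsq x) 1 F (F1 x) &
        hess u x = (2 * F1 x)%:M +
          (4 * ((m ^+ 2 * (1 + p (t (nsq x))) ^+ 2 + 2 * m * (1 + p (t (nsq x)))
            - m * p1 (t (nsq x))) / (4 * nsq x ^+ 2) * u x)) *: (x^T *m x)].
  by move=> Jx; have [_ _ /(_ x Jx)] := radial_solution m0 kn BE yp.
have nsq2 (x : 'rV[R]_n) : nsq x = norm2 x ^+ 2 by rewrite norm2_nsq sqr_sqrtr // nsq_ge0.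
have dom (x : 'rV[R]_n) : (ecball n (expR (h / 2)) `\` eball n 1) x ->
    1 <= nsq x <= expR h.
  rewrite /ecball /eball /= => -[xh /negP]; rewrite -leNgt => x1.
  have xn : 0 <= norm2 x by exact: sqrtr_ge0.
  have -> : expR h = expR (h / 2) ^+ 2.
    by rewrite -expRM_natl; congr expR; field.
  rewrite nsq2 expr_ge1 // x1 /=.
  by rewrite lerXn2r // nnegrE // ltW // expR_gt0.
have domJ s : 1 <= s <= expR h -> expR (- 2 * d) < s < expR (2 * h).
  move=> /andP[s1 sh]; apply/andP; split.
    by rewrite (lt_le_trans _ s1) // -[X in _ < X]expR0 ltr_expR; lra.
  by rewrite (le_lt_trans sh) // ltr_expR; lra.
have domt s : 1 <= s <= expR h -> 0 <= t s <= h / 2.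
  move=> /andP[s1 sh]; have s0 : 0 < s by lra.
  rewrite /t; have : 0 <= ln s by rewrite ln_ge0.
  have : ln s <= h by rewrite -[h]expRK ler_ln ?posrE ?expR_gt0.
  lra.
have Lb s : 1 <= s <= expR h -> `|t s + xi0 - y (t s)| <= M.
  move=> /domt ts; have ys := yt (t s) ltac:(lra).
  have := ler_norm (- ln (- c)); have := ler_norm (ln (- (2 * c))).
  have := normr_ge0 (ln (- c)); have := normr_ge0 (ln (- (2 * c))).
  rewrite normrN ler_norml /M; lra.
have uU x : 1 <= nsq x <= expR h -> U0 <= u x <= U1.
  move=> /Lb; rewrite ler_norml => /andP[L1 L2].
  rewrite /U0 /U1 /u /F /= !ler_expR; apply/andP; split; nra.
have u0 x : 0 < u x by exact: expR_gt0.
have pb s : 1 <= s <= expR h -> -1 < p (t s) < 0.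
  by move=> /domt ts; have [] := yp (t s) ltac:(lra).
have gE (x : 'rV[R]_n) : 1 <= nsq x <= expR h -> grad u x = (2 * F1 x) *: x.
  by move=> /domJ/uP[_ _ dF _]; exact: grad_radial.
have sph (x : 'rV[R]_n) : esphere n 1 x -> nsq x = 1 by rewrite nsq2 => ->; rewrite expr1n.
have eh : (1 : R) <= 1 <= expR h by rewrite lexx -[X in X <= _]expR0 ler_expR ltW.
have t1 : t 1 = 0 by rewrite /t ln1 mul0r.
exists u; split; [split|].
- exists (@nsq R n @^-1` [set s | expR (- 2 * d) < s < expR (2 * h)]).
  by split=> // x /dom/domJ.
- move=> x [xh x1]; have : (ecball n (expR (h / 2)) `\` eball n 1) x.
    by split=> //; exact: ltW.
  by move=> /dom/domJ/uP[].
- by move=> x /dom/domJ/uP[].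
- move=> x xS; have s1 := sph x xS.
  have [_ _ dF _] := uP x ltac:(by rewrite s1; exact: domJ).
  rewrite /radial_deriv (_ : norm2 x = 1) // invr1 scale1r.
  have [_ ->] := is_derive_radial x dF.
  rewrite -/(nsq x) /F1 s1 t1 p0 -/r.
  (* On the unit sphere u^(2/(n-2)) = exp(- xi0), since t and y vanish there. *)
  have -> : u x `^ (n%:R / (n%:R - 2)) = u x * (r / - c).
    rewrite -exi /powR gt_eqF // /u /F /= s1 t1 y0 expRK -expRD; congr expR.
    rewrite -/N /m; field; rewrite gt_eqF //; lra.
  rewrite -/N -/m; field; rewrite lt_eqF //.
- move=> x [xh x1]; have xd : 1 <= nsq x <= expR h.
    by apply: dom; split=> //; exact: ltW.
  have /andP[ux0 ux1] := uU x xd; have ux := u0 x.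
  have U1i : (u x)^-1 <= U1.
    rewrite -[U1]invrK lef_pV2 ?posrE ?invr_gt0 ?expR_gt0 //.
    by rewrite /U1 -expRN -mulNr.
  rewrite (gtr0_norm ux) gtr0_norm ?invr_gt0 //.
  have : norm2 (grad u x) <= m * U1.
    have /andP[s1 _] := xd; have /andP[q1 q2] := pb _ xd.
    have s0 : 0 < nsq x by lra.
    have z0 : 0 <= m * (1 + p (t (nsq x))) * u x.
      by rewrite !mulr_ge0 ?(ltW m0) ?(ltW ux) //; lra.
    have z1 : m * (1 + p (t (nsq x))) * u x <= m * U1.
      rewrite -mulrA ler_pM2l // -[X in _ <= X]mul1r ler_pM ?(ltW ux) //; lra.
    have U10 : 0 <= m * U1 := le_trans z0 z1.
    rewrite gE // norm2_nsq nsqZ -[m * U1]ger0_norm // -sqrtr_sqr ler_wsqrtr //.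
    have -> : (2 * F1 x) ^+ 2 * nsq x =
        (m * (1 + p (t (nsq x))) * u x) ^+ 2 / nsq x.
      by rewrite /F1; field; rewrite gt_eqF.
    rewrite ler_pdivrMr // -[X in X <= _]mulr1 ler_pM ?sqr_ge0 //.
    by rewrite lerXn2r.
  by rewrite mulrDl; lra.
- move=> x xS; have s1 := sph x xS.
  have xd : 1 <= nsq x <= expR h by rewrite s1.
  have [_ _ _ hE] := uP x (domJ _ xd).
  have /andP[ux0 ux1] := uU x xd; have ux := u0 x.
  have trE : \tr (hess u x) = - (u x * m * (p1 0 + m * (1 - r ^+ 2))).
    rewrite hE mxtrace_scalar_rank1 /F1 s1 t1 p0 -/r -/N.
    have -> : N = 2 * m + 2 by rewrite /m; field.
    by field.
  have pE : p1 0 = B * e^-1 ^+ k - q / K * e.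
    rewrite /p1 y0 p0 -/r sqrrN r2 mulr0 expR0 mulr1.
    have -> : 1 - (1 - 2 * e) = 2 * e by ring.
    have -> : 2 / (2 * e) = e^-1 by field; rewrite gt_eqF.
    by rewrite [2 * e]mulrC mulfK.
  have BB : B0 <= B.
    have -> : B = a^-1 * expR (- (2 * K * xi0)).
      by rewrite /B /A /A0; field; rewrite !gt_eqF.
    by rewrite ler_pM2l ?invr_gt0 // ler_expR lerN2 ler_pM2l //; lra.
  have ei1 : 1 <= e^-1 by rewrite invf_ge1 //; lra.
  (* Here k >= 2 of the theorem is used: the shifted exponent is at least 1, so the power of [e^-1]
     dominates [e^-1]. *)
  have Bk : B0 / e <= B * e^-1 ^+ k.
    by rewrite ler_pM ?(ltW B00) ?invr_ge0 ?(ltW e0) // ler_eXnr.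
  have qK : q / K * e <= N.
    have : q / K <= N by rewrite ler_pdivrMr // /q; nra.
    rewrite -(ler_pM2r e0) => /le_trans; apply.
    by rewrite ler_piMr ?(ltW N0) //; lra.
  have p1b : B0 / e - N <= p1 0 by rewrite pE lerD // lerN2.
  have trb : u x * m * (B0 / e - N) <= N * norm2 (hess u x).
    apply: le_trans (norm_trace_le _); rewrite trE normrN.
    apply: le_trans (ler_norm _); rewrite (ler_pM2l (mulr_gt0 ux m0)).
    have : 0 <= m * (1 - r ^+ 2) by rewrite mulr_ge0 ?(ltW m0) // r2; lra.
    lra.
  have T1 : U0 * m * B0 / e <= u x * m * (B0 / e).
    have mB : 0 <= m * (B0 / e) by rewrite ltW // mulr_gt0 // divr_gt0.
    have -> : U0 * m * B0 / e = U0 * (m * (B0 / e)) by ring.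
    have -> : u x * m * (B0 / e) = u x * (m * (B0 / e)) by ring.
    exact: ler_wpM2r.
  have T2 : u x * m * N <= U1 * m * N.
    by rewrite ler_wpM2r ?(ltW N0) // ler_wpM2r // ltW.
  apply: (@le_trans _ _ ((U0 * m * B0 / e - U1 * m * N) / N)).
    by rewrite le_eqVlt; apply/orP; left; apply/eqP; field; rewrite !gt_eqF.
  rewrite ler_pdivrMr // mulrC; rewrite mulrBr in trb; lra.
Qed.

Theorem lemma13 (R : realType) (n : nat) (hn : (3 <= n)%N) (k : nat)
    (hk : (2 <= k <= n)%N) (c : R) (hc : c < 0) :
  exists (C0 R0 : R) (u : nat -> 'rV[R]_n -> R),
    [/\ 0 < C0,
        1 < R0,
        (forall j : nat, (1 <= j)%N ->
          [/\ smooth_upto (ecball n R0 `\` eball n 1) (u j),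
              (forall x, (eball n R0 `\` eball n 1) x ->
                 sigma k (eigvals (confA (u j) x)) = 1),
              (forall x, (ecball n R0 `\` eball n 1) x ->
                 0 < u j x /\ Gamma_cone k (eigvals (confA (u j) x))),
              (forall x, esphere n 1 x ->
                 radial_deriv (u j) x + (n%:R - 2) / 2 * u j x =
                 - ((n%:R - 2) / 2 * c * u j x `^ (n%:R / (n%:R - 2)))) &
              (forall x, (eball n R0 `\` eball n 1) x ->
                 `|u j x| + `|(u j x)^-1| + norm2 (grad (u j) x) <= C0)]) &
        (fun j : nat => inf [set norm2 (hess (u j) x) | x in esphere n 1])
          @ \oo --> +oo].
Proof.
case: k hk => [|k] // /andP[k1 kn].
have [C0 [R0 [e0 [M0 [M1 [C00 R01 e00 M00 fam]]]]]] := solution_family hn k1 kn hc.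
have ej (j : nat) : 0 < e0 / j.+1%:R <= e0.
  rewrite divr_gt0 ?ltr0n //= ler_pdivrMr ?ltr0n // ler_peMr ?(ltW e00) //.
  by rewrite -[X in X <= _]/(1%:R) ler_nat.
have /choice[u uP] := fun j => fam _ (ej j).
exists C0, R0, u; split => //; first by move=> j _; have [] := uP j.
(* A point of the sphere: a lower bound passes to [inf] only for a nonempty set. *)
pose x0 : 'rV[R]_n := delta_mx 0 (Ordinal (ltn_trans (ltn0Sn 1) hn)).
have x0S : esphere n 1 x0.
  by rewrite /esphere /= norm2_nsq /nsq dot_delta mxE !eqxx sqrtr1.
apply/cvgryPge => A; near=> j.
apply: (@le_trans _ _ (M0 / (e0 / j.+1%:R) - M1)).
  rewrite invf_div mulrCA mulrC lerBrDr -ler_pdivrMl ?divr_gt0 //.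
  rewrite -natr1 -lerBlDr; near: j; exact: nbhs_infty_ger.
apply: lb_le_inf; first by exists (norm2 (hess (u j) x0)); exists x0.
by move=> _ [x xS <-]; have [_] := uP j; apply.
Unshelve. all: by end_near. Qed.
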